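(* Let $1\le p<q\le\infty$ and $K\ge1$. For any i.i.d.-based algorithm $A$ on $\mathcal Y_{p,q,K}$, $$\sup_{Y\in\mathcal Y_{p,q,K}}\mathbb E|A(Y)-\mathbb E Y|=\infty.$$
   Context: Random variables are real-valued on a probability space $(\Omega,\Sigma,\mathbb P)$, assumed rich enough to carry all random variables considered (random variables with arbitrary distributions, sequences of i.i.d. copies, independent auxiliary randomness). $\|X\|_q=(\mathbb E|X|^q)^{1/q}$ for $q<\infty$ and $\|X\|_\infty$ is the essential supremum of $|X|$. For $1\le p<q\le\infty$ and $K\ge1$, $$\mathcal Y_{p,q,K}:=\{Y\in L_q\mid \|Y-\mathbb E Y\|_q\le K\|Y-\mathbb E Y\|_p\}.$$ An i.i.d.-based algorithm on a class $\mathcal Y$ of random variables consists of: an auxiliary random variable $U$ with values in a measurable space $(\mathbb U,\Sigma_U)$; a measurable $\phi:\mathbb U\times\mathbb R^{\mathbb N}\to\mathbb R$; and a measurable stopping rule $n:\mathbb U\times\mathbb R^{\mathbb N}\to\mathbb N_0\cup\{\infty\}$ such that whether $n(u,(y_j)_j)\ge i$ depends only on $(u,y_1,\dots,y_{i-1})$. For $Y\in\mathcal Y$ with i.i.d. copies $(Y_i)_{i\in\mathbb N}$, independent of $U$, put $n(\omega,Y):=n(U(\omega),(Y_i(\omega))_i)$, assumed almost surely finite for each $Y\in\mathcal Y$, and $A(\omega,Y):=\phi(U(\omega),Y_1(\omega),\dots,Y_{n(\omega,Y)}(\omega),0,0,\dots)$; $A(Y):=A(\cdot,Y)$. *)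

(* Defs.v *)
From HB Require Import structures.
From mathcomp Require Import all_boot all_order all_algebra finmap.
From mathcomp Require Import all_classical all_reals all_analysis.

Set Implicit Arguments.
Unset Strict Implicit.
Unset Printing Implicit Defensive.

Import Order.TTheory GRing.Theory Num.Theory.
Import numFieldNormedType.Exports.

Local Open Scope classical_set_scope.
Local Open Scope ring_scope.

(* R^N with its product sigma-algebra. All sequences are indexed from 0, so
   that y_1, y_2, ... of the mathematical text are y 0, y 1, ... *)
Definition real_seq (R : realType) :=
  g_sigma_algebraType
    (\bigcup_(i in [set: nat])
       preimage_set_system [set: nat -> R] (fun y => y i)
         (@measurable _ R)).

Section random_variables.
Context d (T : measurableType d) (R : realType) (P : probability T R).

Definition mean (Y : T -> R) : R := fine 'E_P[Y].

Definition centered (Y : T -> R) : T -> R := fun w => Y w - mean Y.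

(* Every law on the real line is the law of some random variable on (T, P).
   Laws are compared on measurable sets only, because the value of a measure
   on a nonmeasurable set is unspecified. *)
Definition carries_all_laws : Prop :=
  forall mu : probability R R,
    exists Y : {RV P >-> R},
      forall B, measurable B -> distribution P Y B = mu B.

Definition moment_class (p q : \bar R) (K : R) : set {RV P >-> R} :=
  [set Y | [/\ (Y : T -> R) \in Lfun P q &
    ('N[P]_q [EFin \o centered Y]
       <= K%:E * 'N[P]_p [EFin \o centered Y])%E]].

Definition identically_distributed (X Y : {RV P >-> R}) : Prop :=
  forall B, measurable B -> distribution P X B = distribution P Y B.

Definition mutually_independent (X : nat -> {RV P >-> R}) : Prop :=
  forall (J : {fset nat}) (B : nat -> set R),
    (forall i, measurable (B i)) ->
    P (\bigcap_(i in [set` J]) (X i @^-1` B i)) =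
    (\prod_(i <- J) P (X i @^-1` B i))%E.

Definition sample (X : nat -> {RV P >-> R}) (w : T) : real_seq R :=
  fun i => X i w.

Definition independent_of d' (E : measurableType d') (U : {RV P >-> E})
    (X : nat -> {RV P >-> R}) : Prop :=
  forall (B : set E) (C : set (real_seq R)), measurable B -> measurable C ->
    P ((U @^-1` B) `&` (sample X @^-1` C)) =
    (P (U @^-1` B) * P (sample X @^-1` C))%E.

Definition iid_copies d' (E : measurableType d') (U : {RV P >-> E})
    (Y : {RV P >-> R}) (X : nat -> {RV P >-> R}) : Prop :=
  [/\ forall i, identically_distributed (X i) Y,
      mutually_independent X &
      independent_of U X].

End random_variables.

Arguments moment_class {d T R} P p q K.

(* [None] stands for the value infinity of a stopping rule. *)
Definition at_least (i : nat) (m : option nat) : bool :=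
  if m is Some k then (i <= k)%N else true.

(* (y_1, ..., y_m, 0, 0, ...) *)
Definition truncate (R : realType) (m : option nat) (y : real_seq R) :
  real_seq R := fun j => if at_least j.+1 m then y j else 0.

(* An i.i.d.-based algorithm on the class [C], together with the i.i.d. copies
   of each [Y] in [C] that it is fed with. Measurability of [stop] refers to
   the discrete sigma-algebra; [stop_adapted] is trivial for the bound 0, so
   only the bounds i.+1 appear. *)
Record iid_algorithm d (T : measurableType d) (R : realType)
    (P : probability T R) d' (E : measurableType d')
    (C : set {RV P >-> R}) := IidAlgorithm {
  aux : {RV P >-> E} ;
  phi : {mfun (E * real_seq R)%type >-> R} ;
  stop : E * real_seq R -> option nat ;
  stop_measurable : forall S : set (option nat), measurable (stop @^-1` S) ;
  stop_adapted : forall (i : nat) (u : E) (y z : real_seq R),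
    (forall j, (j < i)%N -> y j = z j) ->
    at_least i.+1 (stop (u, y)) = at_least i.+1 (stop (u, z)) ;
  copies : {RV P >-> R} -> nat -> {RV P >-> R} ;
  copies_iid : forall Y, C Y -> iid_copies aux Y (copies Y) ;
  stop_finite : forall Y, C Y ->
    {ae P, forall w, stop (aux w, sample (copies Y) w) <> None}
}.

Definition output d (T : measurableType d) (R : realType)
    (P : probability T R) d' (E : measurableType d')
    (C : set {RV P >-> R}) (A : iid_algorithm E C)
    (Y : {RV P >-> R}) (w : T) : R :=
  let y := sample (copies A Y) w in
  phi A (aux A w, truncate (stop A (aux A w, y)) y).

(* Main.v *)
(* If the algorithm reads only zeros it must stop after some [n] of them, with
   an output bounded by [n], on an event of positive probability: otherwise it
   would not stop on the constant variable 0. The variable [Y] taking the values 0 and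
   [2 s] with probability 1/2 satisfies [|Y - E Y| = s], so it lies in the class
   whatever [p], [q] and [K] are. Its first [n] samples vanish with probability
   [2 ^ -n], independently of the auxiliary randomness, and then the error is at
   least [s - n]. Let [s] tend to infinity. *)
From HB Require Import structures.
Require Import Defs.
From mathcomp Require Import all_boot all_order all_algebra finmap lra.
From mathcomp Require Import all_classical all_reals all_analysis.
From mathcomp Require Import measurable_realfun ess_sup_inf.

Set Implicit Arguments.
Unset Strict Implicit.
Unset Printing Implicit Defensive.

Import Order.TTheory GRing.Theory Num.Theory.
Import numFieldNormedType.Exports HBNNSimple.

Local Open Scope classical_set_scope.
Local Open Scope ring_scope.

(** * Variables of constant modulus and two-point variables *)

Lemma Lnorm_cst_abs (d : measure_display) (T : measurableType d)
    (R : realType) (P : probability T R) (p : \bar R) (f : T -> R) (s : R) :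
  (0 < p)%E -> (forall w, `|f w| = s) -> 'N[P]_p[EFin \o f]%E = s%:E.
Proof.
move=> p0 fs.
have s0 : 0 <= s by rewrite -(fs point).
have PT : (P : {measure set T -> \bar R}) [set: T] = 1%E := probability_setT P.
rewrite unlock; case: p p0 => [r||//] r0.
  under eq_integral do rewrite /= fs.
  by rewrite integral_cst//= PT mule1 /= -powRrM mulfV ?gt_eqF// powRr1.
rewrite PT lte01 (_ : abse \o _ = cst s%:E).
  by apply: ess_sup_cst; rewrite PT lte01.
by apply/funext => w /=; rewrite fs.
Qed.

(* [f] need not be measurable, unlike in [ge0_le_integral]. *)
Lemma ge0_integral_ge (d : measure_display) (T : measurableType d)
    (R : realType) (mu : {measure set T -> \bar R}) (B : set T) (f : T -> \bar R)
    (r : R) :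
  measurable B -> 0 <= r -> (forall w, 0 <= f w)%E ->
  (forall w, B w -> r%:E <= f w)%E -> (r%:E * mu B <= \int[mu]_w f w)%E.
Proof.
move=> mB r0 f0 rf; rewrite ge0_integralTE//.
(* The integral of a nonnegative function is a supremum over the simple functions below it;
   [r * \1_B] is one of them. *)
pose h := scale_nnsfun (indic_nnsfun R mB) r0.
apply: ereal_sup_ubound; exists h => /=.
  move=> w; rewrite -[X in (X%:E <= _)%E]/(r * \1_B w) indicE.
  have [/set_mem Bw|_] := boolP (w \in B).
    by rewrite mulr1; exact: rf.
  by rewrite mulr0.
by rewrite sintegralrM; congr (_ * _)%E; exact: sintegral_indic.
Qed.

(** Richness is applied to the law of a fair coin with real values 0 and 1; the event is that a
    variable with this law equals 1. *)
Lemma event_half (d : measure_display) (T : measurableType d)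
    (R : realType) (P : probability T R) : carries_all_laws P ->
  exists2 A : set T, measurable A & P A = (2^-1)%:E.
Proof.
pose f (b : bool) : R := b%:R.
have mf : measurable_fun setT f by [].
pose F : {RV (bernoulli_prob (2^-1 : R)) >-> R} :=
  HB.pack f (isMeasurableFun.Build _ _ _ _ f mf).
move=> rich; have [Y YE] := rich (distribution (bernoulli_prob (2^-1 : R)) F).
exists (Y @^-1` [set 1]); first exact: measurable_funPTI.
have F1 : F @^-1` [set 1] = [set true].
  by apply/seteqP; split => -[] //= /eqP; rewrite /F/= /f/= eq_sym oner_eq0.
transitivity (bernoulli_prob (2^-1 : R) (F @^-1` [set 1])).
  exact: YE (measurable_set1 1).
have h01 : 0 <= (2^-1 : R) <= 1 by lra.
by rewrite F1 bernoulli_probE// !diracE mem_set// memNset// mule0 adde0 mule1.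
Qed.

Lemma two_point_rv (d : measure_display) (T : measurableType d) (R : realType)
    (P : probability T R) (A : set T) (s : R) :
  measurable A -> exists Y : {RV P >-> R}, forall w, Y w = s * \1_A w.
Proof.
move=> mA; pose f w := s * \1_A w.
have mf : measurable_fun setT f.
  by apply: measurable_funM => //; exact: measurable_indic.
pose F : {mfun T >-> R} := HB.pack f (isMeasurableFun.Build _ _ _ _ f mf).
by exists F.
Qed.

Lemma Lfun_cst_abs (d : measure_display) (T : measurableType d)
    (R : realType) (P : probability T R) (p : \bar R) (f : T -> R) (s : R) :
  (0 < p)%E -> measurable_fun setT f -> (forall w, `|f w| = s) ->
  f \in Lfun P p.
Proof.
move=> p0 mf fs; rewrite inE; apply/andP; split; first by rewrite inE.
by rewrite inE /= /finite_norm (Lnorm_cst_abs P p0 fs) ltry.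
Qed.

(** Since [|Y - s| = s] everywhere and [P] has mass one, the centered norms of all orders equal [s],
    and the class inequality becomes [s <= K * s]. The case [s = 0] gives the constant 0. *)
Lemma two_point_class (d : measure_display) (T : measurableType d)
    (R : realType) (P : probability T R) (A : set T) (p q : \bar R) (K s : R)
    (Y : {RV P >-> R}) :
  (1 <= p)%E -> (p < q)%E -> 1 <= K -> measurable A -> P A = (2^-1)%:E ->
  0 <= s -> (forall w, Y w = 2 * s * \1_A w) ->
  mean P Y = s /\ moment_class P p q K Y.
Proof.
move=> p1 pq K1 mA PA s0 YE.
have meanY : mean P Y = s.
  rewrite /mean unlock; under eq_integral do rewrite /= YE EFinM.
  rewrite ge0_integralZl_EFin//=; last 2 first.
  - by apply/measurable_EFinP; exact: measurable_indic.
  - by rewrite mulr_ge0.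
  rewrite integral_indic// setIT (_ : _ A = (2^-1)%:E)//=.
  lra.
have p0 : (0 < p)%E by rewrite (lt_le_trans _ p1).
have q0 : (0 < q)%E by rewrite (lt_trans p0).
have abs_centered w : `|centered P Y w| = s.
  rewrite /centered meanY YE indicE; case: (w \in A).
    by rewrite mulr1 ger0_norm; lra.
  by rewrite mulr0 sub0r normrN ger0_norm.
have mC : measurable_fun setT (centered P Y).
  by apply: measurable_funB.
split=> //; split; last first.
  rewrite !(Lnorm_cst_abs _ _ abs_centered)// -EFinM lee_fin.
  by rewrite ler_peMl.
(* Both summands have modulus [s], so each of them lies in [Lfun P q]. *)
have -> : (Y : T -> R) = centered P Y + cst s.
  by apply/funext => w; rewrite /centered meanY /= fctE subrK.
apply: (Lfun_addr_closed _ (le_trans p1 (ltW pq))).2.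
  exact: Lfun_cst_abs abs_centered.
by apply: (@Lfun_cst_abs _ _ _ _ _ _ s) => // w; rewrite ger0_norm.
Qed.

Lemma measurable_prefix0 (R : realType) (n : nat) :
  @measurable _ (real_seq R) [set y | forall i, (i < n)%N -> y i = 0].
Proof.
rewrite (_ : [set _ | _] =
  \bigcap_(i in `I_n) ((fun y : nat -> R => y i) @^-1` [set 0])); last first.
  by apply/seteqP; split => y yP i; exact: yP.
apply: fin_bigcap_measurable => // i _; apply: sub_sigma_algebra.
exists i => //; exists [set 0]; first exact: measurable_set1.
by rewrite setTI.
Qed.

(** * The algorithm on zero samples *)

Section algorithm.
Context (d : measure_display) (T : measurableType d) (R : realType)
  (P : probability T R) (d' : measure_display) (E : measurableType d')
  (C : set {RV P >-> R}) (A : iid_algorithm E C).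

Let zeros : real_seq R := fun=> 0.

(** A single [n] bounds both the number of samples read and the answer, so that countably many such
    sets cover every [u] for which the algorithm stops on zeros. The value [false] at [n.+1] also
    excludes [None]. *)
Definition settled (n : nat) : set E :=
  [set u | at_least n.+1 (stop A (u, zeros)) = false
           /\ `|phi A (u, zeros)| <= n%:R].

Lemma measurable_settled n : measurable (settled n).
Proof.
have mpair : measurable_fun setT (fun u : E => (u, zeros)).
  exact: pair2_measurable.
apply: measurableI.
  rewrite -[X in measurable X]setTI.
  exact: (mpair measurableT _
    (stop_measurable A [set m | at_least n.+1 m = false])).
have mphi : measurable_fun setT (fun u : E => `|phi A (u, zeros)|).
  by apply: measurableT_comp => //; exact: measurableT_comp mpair.
rewrite -[X in measurable X]setTI.
have := mphi measurableT _ (measurable_itv `]-oo, n%:R]).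
by congr measurable; apply/seteqP; split => u; rewrite /= in_itv.
Qed.

(** Otherwise the union over [n] is null, although almost every outcome has only zero samples and a
    finite stopping time, hence lies in this union. *)
Lemma settled_pos (Y : {RV P >-> R}) : C Y -> (forall w, Y w = 0) ->
  exists n, (0 < P (aux A @^-1` settled n))%E.
Proof.
move=> CY Y0; apply/not_existsP => null.
have [idX _ _] := copies_iid A CY.
(* The copies share only the law of [Y], so they vanish almost surely rather than everywhere. *)
have ae0 : {ae P, forall w i, copies A Y i w = 0}.
  apply: ae_foralln => i.
  have mX : measurable (copies A Y i @^-1` [set 0]).
    exact: measurable_funPTI.
  have PX : P (copies A Y i @^-1` [set 0]) = 1%E.
    transitivity (P (Y @^-1` [set 0])); first exact: idX (measurable_set1 0).
    by rewrite -(probability_setT P); congr (P _); apply/seteqP; split => w _ /=.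
  have PXC : P (~` (copies A Y i @^-1` [set 0])) = 0%E.
    by rewrite probability_setC// PX subee.
  by exists (~` (copies A Y i @^-1` [set 0])); split; first exact: measurableC.
have neg : P.-negligible (\bigcup_n (aux A @^-1` settled n)).
  apply: negligible_bigcup => n; apply/negligibleP.
    by apply: measurable_funPTI; exact: measurable_settled.
  by apply/eqP; rewrite eq_le measure_ge0 andbT leNgt; apply/negP; exact: null.
have aeN : {ae P, forall w, ~ (\bigcup_n (aux A @^-1` settled n)) w}.
  by apply: negligibleS neg => w /= /contrapT.
have : {ae P, forall w, False}.
  have fin := stop_finite A CY.
  near=> w.
  have sw : sample (copies A Y) w = zeros.
    by apply/funext => i; rewrite /sample; move: i; near: w.
  suff : (\bigcup_n (aux A @^-1` settled n)) w by near: w.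
  have : stop A (aux A w, sample (copies A Y) w) <> None by near: w.
  rewrite sw; case E0 : (stop A (aux A w, zeros)) => [k|]// _.
  exists (maxn k (Num.bound `|phi A (aux A w, zeros)|)) => //.
  split.
    by rewrite E0 /=; apply/negbTE; rewrite -leqNgt leq_maxl.
  by rewrite (le_trans (ltW (archi_boundP _)))// ler_nat leq_maxr.
(* A null set containing every outcome contradicts total mass one. *)
move=> [N [mN PN TN]].
have := probability_setT P.
rewrite (_ : setT = N) ?PN.
  by move=> /eqP; rewrite eq_sym onee_eq0.
by apply/seteqP; split => // w _; apply: TN.
Unshelve. all: by end_near.
Qed.

(** Whether sample number [n + 1] is read depends on the first [n] samples only. These are zeros, so
    the algorithm stops by then and its truncated input is the zero sequence. *)
Lemma settled_output (n : nat) (Y : {RV P >-> R}) (w : T) :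
  settled n (aux A w) -> (forall i, (i < n)%N -> copies A Y i w = 0) ->
  `|output A Y w| <= n%:R.
Proof.
move=> [stopn phin] X0; rewrite /output.
set y := sample _ _.
have y0 j : (j < n)%N -> y j = 0 by exact: X0.
rewrite (_ : truncate _ y = zeros)//.
have := stop_adapted A (aux A w) (y := y) (z := zeros) y0.
rewrite stopn; case: (stop _ _) => [m|]//= /negbT; rewrite -leqNgt => mn.
apply/funext => j; rewrite /truncate /=; case: ltnP => // jm.
by rewrite y0// (leq_trans jm).
Qed.

End algorithm.

Theorem theorem3p5 (d : measure_display) (T : measurableType d) (R : realType)
    (P : probability T R) (P_rich : carries_all_laws P)
    (d' : measure_display) (E : measurableType d')
    (p q : \bar R) (K : R)
    (p_ge1 : (1 <= p)%E) (p_lt_q : (p < q)%E) (K_ge1 : 1 <= K)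
    (A : iid_algorithm E (moment_class P p q K)) :
  ereal_sup [set ('E_P[(fun w => `|output A Y w - mean P Y|)%R])%E |
             Y in moment_class P p q K] = +oo%E.
Proof.
have [B mB PB] := event_half P_rich.
have [Y0 Y0E] := two_point_rv P (2 * 0) mB.
have [_ CY0] := two_point_class p_ge1 p_lt_q K_ge1 mB PB (lexx 0) Y0E.
have [n Pn] : exists n, (0 < P (aux A @^-1` settled A n))%E.
  by apply: settled_pos CY0 _ => w; rewrite Y0E mulr0 mul0r.
have mG : measurable (aux A @^-1` settled A n).
  by apply: measurable_funPTI; exact: measurable_settled.
pose c := fine (P (aux A @^-1` settled A n)).
have cE : P (aux A @^-1` settled A n) = c%:E.
  by rewrite fineK// fin_num_measure.
have c0 : 0 < c by rewrite -lte_fin -cE.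
pose J := [fset i in iota 0 n]%fset.
(* This is [2 ^ -n], in the product form that mutual independence yields. *)
pose e : R := \prod_(i <- J) 2^-1.
have e0 : 0 < e by apply: prodr_gt0 => i _; rewrite invr_gt0.
apply/eqyP => r r0.
(* Chosen so that an error of [s - n] on an event of probability [c * e] contributes exactly [r]. *)
pose s := n%:R + r / (c * e).
have s0 : 0 < s by rewrite ltr_wpDl// divr_gt0// mulr_gt0.
have [Y YE] := two_point_rv P (2 * s) mB.
have [meanY CY] := two_point_class p_ge1 p_lt_q K_ge1 mB PB (ltW s0) YE.
apply: (@le_trans _ _ ('E_P[(fun w => `|output A Y w - mean P Y|)%R])%E);
  last by apply: ereal_sup_ubound; exists Y.
pose Z := [set y : real_seq R | forall i, (i < n)%N -> y i = 0].
pose W := aux A @^-1` settled A n `&` sample (copies A Y) @^-1` Z.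
have [idX indX UX] := copies_iid A CY.
have PX i : P (copies A Y i @^-1` [set 0]) = (2^-1)%:E.
  transitivity (P (Y @^-1` [set 0])); first exact: idX (measurable_set1 0).
  (* As [s > 0], [Y] vanishes exactly off [B]. *)
  rewrite (_ : Y @^-1` [set 0] = ~` B).
    by rewrite probability_setC// PB -EFinB; congr EFin; lra.
  apply/seteqP; split => w /=; rewrite YE indicE.
    by move=> + Bw; rewrite mem_set// mulr1; lra.
  by move=> Bw; rewrite memNset// mulr0.
have ZE : sample (copies A Y) @^-1` Z =
    \bigcap_(i in [set` J]) (copies A Y i @^-1` [set 0]).
  apply/seteqP; split => w Zw i /= => [iJ|iN].
    by apply: Zw; move: iJ; rewrite !inE/= mem_iota.
  by apply: Zw; rewrite /= !inE /= mem_iota.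
have PZ : P (sample (copies A Y) @^-1` Z) = e%:E.
  rewrite ZE (indX J (fun=> [set 0])) => [|i]; last exact: measurable_set1.
  by rewrite -prodEFin; apply: eq_bigr.
have PW : P W = (c * e)%:E.
  rewrite /W UX; [|exact: measurable_settled|exact: measurable_prefix0].
  by rewrite EFinM -cE -PZ.
have mW : measurable W.
  apply: measurableI => //; rewrite ZE.
  apply: fin_bigcap_measurable => [|i _]; first exact: finite_fset.
  exact: measurable_funPTI.
rewrite unlock (@le_trans _ _ ((s - n%:R)%:E * P W)%E)//.
  by rewrite PW -EFinM lee_fin /s addrAC subrr add0r divfK// gt_eqF// mulr_gt0.
(* This bound asks only for [W] to be measurable, not for the error. *)
apply: ge0_integral_ge => //.
  by rewrite /s addrAC subrr add0r ltW// divr_gt0// mulr_gt0.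
move=> w [Gw Zw]; rewrite lee_fin meanY.
have := settled_output Gw Zw.
(* The mean is [s] and the output is at most [n] in modulus, so the reverse triangle inequality
   gives [s - n]. *)
rewrite distrC => h; rewrite (le_trans _ (lerB_dist _ _))//.
by rewrite ger0_norm ?lerB// ltW.
Qed.
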